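(* Let $(X,\mathbb{A},d)$ be a complete $C^*$-algebra valued metric space, where $\mathbb{A}$ is a unital $C^*$-algebra. Let $T,S:X\to X$ be mappings such that $$d(T^n x,S^n y)\preceq q(x,y)^n\,\delta(x,y)\quad\text{for all }x,y\in X,\ n\in\mathbb{N},$$ where $q:X\times X\to\acute{\mathbb{A}}_+$ satisfies $0\le\|q(x,y)\|<1$ for all $x,y\in X$ and $\delta:X\times X\to\mathbb{A}_+$ is a mapping. Then $T$ and $S$ are both orbitally continuous on $X$ if and only if $T$ and $S$ have a unique common fixed point in $X$.
   Context: $\mathbb{A}$ denotes a unital $C^*$-algebra with unit $I$ and zero $\theta$. An element $a\in\mathbb{A}$ is positive, written $a\succeq\theta$, if $a^*=a$ and its spectrum is contained in $[0,\infty)$; $\mathbb{A}_+$ is the set of positive elements, and $a\succeq b$ means $a-b\succeq\theta$. $\acute{\mathbb{A}}_+$ denotes the set of positive elements of $\mathbb{A}$ that commute with every element of $\mathbb{A}$. A $C^*$-algebra valued metric space $(X,\mathbb{A},d)$ is a nonempty set $X$ with $d:X\times X\to\mathbb{A}$ such that for all $x,y,z\in X$: $d(x,y)\succeq\theta$, with $d(x,y)=\theta$ iff $x=y$; $d(x,y)=d(y,x)$; $d(x,y)\preceq d(x,z)+d(z,y)$. A sequence $\{x_n\}$ converges to $x$ if $\|d(x_n,x)\|\to0$, and is Cauchy if $\|d(x_n,x_m)\|\to0$ as $n,m\to\infty$; the space is complete if every Cauchy sequence converges to a point of $X$. A self-map $T$ of $X$ is orbitally continuous at $u\in X$ if for every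 $x\in X$ and every increasing sequence of positive integers $\{n_i\}$, $\|d(T^{n_i}x,u)\|\to0$ implies $\|d(T^{n_i+1}x,Tu)\|\to0$ as $i\to\infty$; $T$ is orbitally continuous on $X$ if it is orbitally continuous at every $u\in X$. *)

(* Defs.v *)
From Stdlib Require Import Reals.
Open Scope R_scope.

Definition Cx : Type := (R * R)%type.
Definition Cre (z : Cx) : R := fst z.
Definition Cim (z : Cx) : R := snd z.
Definition Cadd (z w : Cx) : Cx := (fst z + fst w, snd z + snd w).
Definition Cmul (z w : Cx) : Cx :=
  (fst z * fst w - snd z * snd w, fst z * snd w + snd z * fst w).
Definition Cconj (z : Cx) : Cx := (fst z, - snd z).
Definition Cmod (z : Cx) : R := sqrt (fst z * fst z + snd z * snd z).
Definition C1 : Cx := (1, 0).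

Record CStarAlgebra := {
  car :> Type;
  zero : car;
  one : car;
  add : car -> car -> car;
  opp : car -> car;
  mul : car -> car -> car;
  scal : Cx -> car -> car;
  star : car -> car;
  norm : car -> R;
  add_assoc : forall a b c, add a (add b c) = add (add a b) c;
  add_comm : forall a b, add a b = add b a;
  add_zero : forall a, add a zero = a;
  add_opp : forall a, add a (opp a) = zero;
  scal_one : forall a, scal C1 a = a;
  scal_assoc : forall z w a, scal z (scal w a) = scal (Cmul z w) a;
  scal_addl : forall z w a, scal (Cadd z w) a = add (scal z a) (scal w a);
  scal_addr : forall z a b, scal z (add a b) = add (scal z a) (scal z b);
  mul_assoc : forall a b c, mul a (mul b c) = mul (mul a b) c;
  mul_addl : forall a b c, mul (add a b) c = add (mul a c) (mul b c);
  mul_addr : forall a b c, mul a (add b c) = add (mul a b) (mul a c);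
  mul_onel : forall a, mul one a = a;
  mul_oner : forall a, mul a one = a;
  scal_mull : forall z a b, scal z (mul a b) = mul (scal z a) b;
  scal_mulr : forall z a b, scal z (mul a b) = mul a (scal z b);
  star_invol : forall a, star (star a) = a;
  star_add : forall a b, star (add a b) = add (star a) (star b);
  star_scal : forall z a, star (scal z a) = scal (Cconj z) (star a);
  star_mul : forall a b, star (mul a b) = mul (star b) (star a);
  norm_eq0 : forall a, norm a = 0 <-> a = zero;
  norm_triangle : forall a b, norm (add a b) <= norm a + norm b;
  norm_scal : forall z a, norm (scal z a) = Cmod z * norm a;
  norm_submult : forall a b, norm (mul a b) <= norm a * norm b;
  norm_cstar : forall a, norm (mul (star a) a) = norm a * norm a;
  complete : forall u : nat -> car,
    (forall eps, eps > 0 -> exists N, forall n m, (n >= N)%nat -> (m >= N)%nat ->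
        norm (add (u n) (opp (u m))) < eps) ->
    exists l, Un_cv (fun n => norm (add (u n) (opp l))) 0
}.

Arguments zero {_}. Arguments one {_}. Arguments add {_}. Arguments opp {_}.
Arguments mul {_}. Arguments scal {_}. Arguments star {_}. Arguments norm {_}.

Definition sub {A : CStarAlgebra} (a b : A) : A := add a (opp b).

Definition invertible {A : CStarAlgebra} (a : A) : Prop :=
  exists b : A, mul a b = one /\ mul b a = one.

Definition in_spectrum {A : CStarAlgebra} (a : A) (l : Cx) : Prop :=
  ~ invertible (sub a (scal l one)).

Definition apositive {A : CStarAlgebra} (a : A) : Prop :=
  star a = a /\ forall l, in_spectrum a l -> Cim l = 0 /\ Cre l >= 0.

Definition ale {A : CStarAlgebra} (a b : A) : Prop := apositive (sub b a).

Definition central_positive {A : CStarAlgebra} (a : A) : Prop :=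
  apositive a /\ forall b : A, mul a b = mul b a.

Fixpoint apow {A : CStarAlgebra} (a : A) (n : nat) : A :=
  match n with O => one | S k => mul a (apow a k) end.

Definition is_cstar_metric {A : CStarAlgebra} {X : Type} (d : X -> X -> A) : Prop :=
  (forall x y, apositive (d x y)) /\
  (forall x y, d x y = zero <-> x = y) /\
  (forall x y, d x y = d y x) /\
  (forall x y z, ale (d x y) (add (d x z) (d z y))).

Definition converges {A : CStarAlgebra} {X : Type} (d : X -> X -> A)
  (u : nat -> X) (x : X) : Prop :=
  Un_cv (fun n => norm (d (u n) x)) 0.

Definition cauchy {A : CStarAlgebra} {X : Type} (d : X -> X -> A) (u : nat -> X) : Prop :=
  forall eps, eps > 0 -> exists N, forall n m, (n >= N)%nat -> (m >= N)%nat ->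
    norm (d (u n) (u m)) < eps.

Definition complete_metric {A : CStarAlgebra} {X : Type} (d : X -> X -> A) : Prop :=
  forall u, cauchy d u -> exists x, converges d u x.

Definition orbitally_continuous_at {A : CStarAlgebra} {X : Type} (d : X -> X -> A)
  (T : X -> X) (u : X) : Prop :=
  forall (x : X) (ni : nat -> nat),
    (forall i, (1 <= ni i)%nat) -> (forall i, (ni i < ni (S i))%nat) ->
    converges d (fun i => Nat.iter (ni i) T x) u ->
    converges d (fun i => Nat.iter (S (ni i)) T x) (T u).

Definition orbitally_continuous {A : CStarAlgebra} {X : Type} (d : X -> X -> A)
  (T : X -> X) : Prop :=
  forall u, orbitally_continuous_at d T u.

(* Main.v *)
(** The only fact about the C*-algebra that is needed is that the norm is monotone on
    positive elements, which turns the hypotheses into real inequalities. It rests on the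
    spectral radius of a self-adjoint [k] with [|k| = 1]: if [1 - z k] were invertible on the
    closed unit disc, the resolvent would be bounded there by compactness, and averaging it
    over the [2^m]-th roots of unity would show that [(1 - k^(2^m))^-1] tends to [1],
    although [|k^(2^m)| = 1] by the C*-identity.

    If [T] and [S] are orbitally continuous, [T^n x] and [T^(n+1) x = T^n (T x)] are both
    geometrically close to [S^n x]; hence the orbit of [x] under [T] is Cauchy, the orbit
    under [S] has the same limit, and that limit is fixed by both maps. Conversely, all
    orbits converge to a common fixed point, which makes orbital continuity automatic. *)

From Stdlib Require Import Reals Lra Lia Classical ClassicalEpsilon.
From Stdlib Require Ncring Ncring_tac.
From Coquelicot Require Compactness Complex.
Require Import Defs.
Open Scope R_scope.

Local Infix "[+]" := add (at level 50, left associativity).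
Local Infix "[-]" := sub (at level 50, left associativity).
Local Infix "[*]" := mul (at level 40, left associativity).

(** * Noncommutative ring normalisation in a C*-algebra *)

#[local] Instance cstar_ring_ops {A : CStarAlgebra} :
  @Ncring.Ring_ops A zero one add mul sub opp eq := {}.

#[local] Instance cstar_ring {A : CStarAlgebra} :
  @Ncring.Ring A _ _ _ _ _ _ _ cstar_ring_ops.
Proof.
  split; try (repeat intro; subst; reflexivity); try typeclasses eauto.
  - intro x. transitivity (add x zero); [apply add_comm | apply add_zero].
  - apply add_comm.
  - apply add_assoc.
  - apply mul_onel.
  - apply mul_oner.
  - apply mul_assoc.
  - intros x y z. apply mul_addl.
  - intros x y z. apply mul_addr.
  - apply add_opp.
Qed.

Ltac ncring := Ncring_tac.non_commutative_ring.

(** * Complex scalars *)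

Lemma Cmod_Coquelicot (z : Cx) : Cmod z = Complex.Cmod z.
Proof. unfold Cmod, Complex.Cmod. f_equal. ring. Qed.

Lemma Cmod_ge0 (z : Cx) : 0 <= Cmod z.
Proof. apply sqrt_pos. Qed.

Lemma Cmod_Cmul (z w : Cx) : Cmod (Cmul z w) = Cmod z * Cmod w.
Proof. rewrite !Cmod_Coquelicot. apply Complex.Cmod_mult. Qed.

Lemma Cmul_comm (z w : Cx) : Cmul z w = Cmul w z.
Proof. unfold Cmul. f_equal; ring. Qed.

Lemma Cmod_Cadd (z w : Cx) : Cmod (Cadd z w) <= Cmod z + Cmod w.
Proof. rewrite !Cmod_Coquelicot. apply Complex.Cmod_triangle. Qed.

Lemma Cmod_real (r : R) : Cmod (r, 0) = Rabs r.
Proof.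
  unfold Cmod; simpl. rewrite <- sqrt_Rsqr_abs. f_equal. unfold Rsqr. ring.
Qed.

Lemma Cmod_real_ge0 (r : R) : 0 <= r -> Cmod (r, 0) = r.
Proof. intro Hr. rewrite Cmod_real. now apply Rabs_pos_eq. Qed.

Lemma Cmod_m1 : Cmod (-1, 0) = 1.
Proof. rewrite Cmod_real, Rabs_left; lra. Qed.

Lemma Cmod_le_l1 (x y : R) : Cmod (x, y) <= Rabs x + Rabs y.
Proof.
  replace (x, y) with (Cadd (x, 0) (0, y)) by (unfold Cadd; simpl; f_equal; ring).
  eapply Rle_trans; [apply Cmod_Cadd |].
  apply Rplus_le_compat; right; [apply Cmod_real |].
  unfold Cmod; simpl. rewrite <- sqrt_Rsqr_abs. f_equal. unfold Rsqr. ring.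
Qed.

Lemma Cmod_coord_le (x y : R) : Cmod (x, y) <= 1 -> -1 <= x <= 1 /\ -1 <= y <= 1.
Proof.
  unfold Cmod; simpl. intro H.
  assert (H1 : x * x + y * y <= 1).
  { rewrite <- (sqrt_sqrt (x * x + y * y)) by nra.
    pose proof (sqrt_pos (x * x + y * y)). nra. }
  nra.
Qed.

(** Half-angle formulas, with the sign of [y] carried by the imaginary part of the root. Roots are
    taken in [radially_close_square], to pass from the resolvent of [y] to that of its square. *)
Lemma Csqrt_exists (z : Cx) : exists w, Cmul w w = z.
Proof.
  destruct z as [x y].
  pose proof (sqrt_pos (x * x + y * y)) as Hr.
  pose proof (sqrt_sqrt (x * x + y * y) ltac:(nra)) as Hr2.
  set (r := sqrt (x * x + y * y)) in *.
  assert (Hx : - r <= x <= r) by (split; nra).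
  pose proof (sqrt_sqrt ((r + x) / 2) ltac:(lra)) as Hp.
  pose proof (sqrt_sqrt ((r - x) / 2) ltac:(lra)) as Hm.
  assert (Hpm : sqrt ((r + x) / 2) * sqrt ((r - x) / 2) = Rabs y / 2).
  { rewrite <- sqrt_mult by lra.
    replace ((r + x) / 2 * ((r - x) / 2)) with (Rsqr (y / 2))
      by (unfold Rsqr; nra).
    rewrite sqrt_Rsqr_abs. unfold Rdiv. rewrite Rabs_mult.
    f_equal. apply Rabs_pos_eq. lra. }
  unfold Rabs in Hpm. destruct (Rcase_abs y).
  - exists (sqrt ((r + x) / 2), - sqrt ((r - x) / 2)).
    unfold Cmul; simpl. f_equal; nra.
  - exists (sqrt ((r + x) / 2), sqrt ((r - x) / 2)).
    unfold Cmul; simpl. f_equal; nra.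
Qed.

(** * Norm and inverses *)

Section CStarAlgebra.

Context {A : CStarAlgebra}.

Implicit Types a b c x y : A.

Lemma scal_0 a : scal (0, 0) a = zero.
Proof.
  assert (H : scal (0, 0) a = scal (0, 0) a [+] scal (0, 0) a).
  { rewrite <- scal_addl. f_equal. unfold Cadd; simpl. f_equal; ring. }
  transitivity (scal (0, 0) a [-] scal (0, 0) a); [| ncring].
  rewrite H at 2. ncring.
Qed.

Lemma scal_m1 a : scal (-1, 0) a = opp a.
Proof.
  transitivity (scal C1 a [+] scal (-1, 0) a [-] a); [rewrite scal_one; ncring |].
  rewrite <- scal_addl.
  replace (Cadd C1 (-1, 0)) with ((0, 0) : Cx)
    by (unfold Cadd, C1; simpl; f_equal; ring).
  rewrite scal_0. ncring.
Qed.

Lemma scal_opp (z : Cx) a : scal z (opp a) = opp (scal z a).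
Proof.
  rewrite <- !scal_m1, !scal_assoc. f_equal. unfold Cmul; simpl. f_equal; ring.
Qed.

Lemma scal_sub (z : Cx) a b : scal z (a [-] b) = scal z a [-] scal z b.
Proof. unfold sub. now rewrite scal_addr, scal_opp. Qed.

Lemma star_opp a : star (opp a) = opp (star a).
Proof.
  rewrite <- !scal_m1, star_scal. f_equal. unfold Cconj; simpl. f_equal; ring.
Qed.

Lemma star_sub a b : star (a [-] b) = star a [-] star b.
Proof. unfold sub. now rewrite star_add, star_opp. Qed.

Lemma star_one : star (one : A) = one.
Proof.
  transitivity (star (star one [*] (one : A))).
  - now rewrite star_mul, star_invol, mul_oner.
  - now rewrite mul_oner, star_invol.
Qed.

Lemma star_scal_real (r : R) a : star (scal (r, 0) a) = scal (r, 0) (star a).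
Proof. rewrite star_scal. f_equal. unfold Cconj; simpl. f_equal; ring. Qed.

Lemma norm_zero : norm (zero : A) = 0.
Proof. now apply norm_eq0. Qed.

Lemma norm_opp a : norm (opp a) = norm a.
Proof.
  rewrite <- scal_m1, norm_scal, Cmod_m1. ring.
Qed.

Lemma norm_ge0 a : 0 <= norm a.
Proof.
  pose proof (norm_triangle _ a (opp a)) as H.
  rewrite add_opp, norm_zero, norm_opp in H. lra.
Qed.

Lemma norm_gt0 a : a <> zero -> 0 < norm a.
Proof.
  intro Ha. destruct (norm_ge0 a) as [H | H]; [exact H |].
  exfalso. now apply Ha, norm_eq0.
Qed.

Lemma norm_sub_sym a b : norm (a [-] b) = norm (b [-] a).
Proof. rewrite <- norm_opp. f_equal. ncring. Qed.

Lemma norm_sub_triangle a b c : norm (a [-] c) <= norm (a [-] b) + norm (b [-] c).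
Proof.
  replace (a [-] c) with ((a [-] b) [+] (b [-] c)) by ncring. apply norm_triangle.
Qed.

Lemma norm_sub_le a b : norm (a [-] b) <= norm a + norm b.
Proof. rewrite <- (norm_opp b). apply norm_triangle. Qed.

(* In the zero algebra the unit has norm 0, hence only an inequality. *)
Lemma norm_one_le : norm (one : A) <= 1.
Proof.
  pose proof (norm_cstar A one) as H.
  rewrite star_one, mul_onel in H. pose proof (norm_ge0 (one : A)). nra.
Qed.

Lemma norm_scal_real (r : R) a : 0 <= r -> norm (scal (r, 0) a) = r * norm a.
Proof. intro Hr. now rewrite norm_scal, Cmod_real_ge0. Qed.

Lemma norm_mul3 a b c : norm (a [*] b [*] c) <= norm a * norm b * norm c.
Proof.
  eapply Rle_trans; [apply norm_submult |].
  apply Rmult_le_compat_r; [apply norm_ge0 | apply norm_submult].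
Qed.

Lemma norm_apow a (n : nat) : norm (apow a n) <= norm a ^ n.
Proof.
  induction n as [| n IH]; simpl; [apply norm_one_le |].
  eapply Rle_trans; [apply norm_submult |].
  apply Rmult_le_compat_l; [apply norm_ge0 | exact IH].
Qed.

Lemma apow_comm a (n : nat) : a [*] apow a n = apow a n [*] a.
Proof.
  induction n as [| n IH]; simpl; [ncring |].
  rewrite <- mul_assoc, <- IH. reflexivity.
Qed.

Definition inverse_of a b : Prop := a [*] b = one /\ b [*] a = one.

Lemma invertible_scal (z w : Cx) a :
  Cmul z w = C1 -> invertible a -> invertible (scal z a).
Proof.
  intros Hzw [b [H1 H2]]. exists (scal w b).
  split; rewrite <- scal_mull, <- scal_mulr, scal_assoc, ?H1, ?H2;
    [| rewrite Cmul_comm]; rewrite Hzw; apply scal_one.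
Qed.

(** The resolvent identity: it turns closeness of two elements into closeness of their inverses. *)
Lemma inverse_of_sub a a' b b' :
  inverse_of a b -> inverse_of a' b' -> b [-] b' = b [*] (a' [-] a) [*] b'.
Proof.
  intros [_ H] [H' _].
  transitivity (b [*] (a' [*] b') [-] (b [*] a) [*] b'); [| ncring].
  rewrite H, H'. ncring.
Qed.

(* Partial fractions: [2 / (1 - e^2) = 1 / (1 - e) + 1 / (1 + e)]. *)
Lemma inverse_of_one_sub_square e p q :
  inverse_of (one [-] e) p -> inverse_of (one [+] e) q ->
  inverse_of (one [-] e [*] e) (scal (1 / 2, 0) (p [+] q)).
Proof.
  intros [P1 P2] [Q1 Q2].
  assert (H2 : scal (1 / 2, 0) (one [+] one : A) = one).
  { rewrite scal_addr, <- scal_addl.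
    replace (Cadd (1 / 2, 0) (1 / 2, 0)) with C1; [apply scal_one |].
    unfold Cadd, C1; simpl. f_equal; field. }
  split.
  - rewrite <- scal_mulr. etransitivity; [| exact H2]. f_equal.
    transitivity ((one [+] e) [*] ((one [-] e) [*] p) [+]
                  (one [-] e) [*] ((one [+] e) [*] q)); [ncring |].
    rewrite P1, Q1. ncring.
  - rewrite <- scal_mull. etransitivity; [| exact H2]. f_equal.
    transitivity ((p [*] (one [-] e)) [*] (one [+] e) [+]
                  (q [*] (one [+] e)) [*] (one [-] e)); [ncring |].
    rewrite P2, Q2. ncring.
Qed.

End CStarAlgebra.

(** * Real geometric estimates *)

Lemma pow_lt_eps (r K eps : R) : 0 <= r < 1 -> 0 <= K -> 0 < eps ->
  exists N, forall n, (n >= N)%nat -> K * r ^ n < eps.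
Proof.
  intros Hr HK Heps.
  (* Dividing by [K + 1] rather than [K] covers [K = 0]. *)
  destruct (pow_lt_1_zero r ltac:(rewrite Rabs_pos_eq; lra) (eps / (K + 1)))
    as [N HN]; [apply Rdiv_lt_0_compat; lra |].
  exists N. intros n Hn. specialize (HN n Hn).
  assert (Hp : 0 <= r ^ n) by (apply pow_le; lra).
  rewrite Rabs_pos_eq in HN by exact Hp.
  apply (Rmult_lt_compat_r (K + 1)) in HN; [| lra].
  replace (eps / (K + 1) * (K + 1)) with eps in HN by (field; lra). nra.
Qed.

(** Stated for a bare real function [D], so that it serves both the partial sums of the Neumann
    series and the orbit of [T]. *)
Lemma geometric_cauchy (D : nat -> nat -> R) (r C : R) :
  0 <= r < 1 -> 0 <= C ->
  (forall n, D n n = 0) -> (forall n m, D n m = D m n) ->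
  (forall n m, D n (S m) <= D n m + D m (S m)) ->
  (forall n, D n (S n) <= C * r ^ n) ->
  forall eps, eps > 0 -> exists N, forall n m, (n >= N)%nat -> (m >= N)%nat ->
    D n m < eps.
Proof.
  intros Hr HC H0 Hsym Htri Hstep eps Heps.
  (* The telescoped geometric sum, multiplied by [1 - r] so that the induction involves no
     division. *)
  assert (Hsum : forall n k, D n (n + k)%nat * (1 - r) <= C * (r ^ n - r ^ (n + k))).
  { intros n k. induction k as [| k IH].
    - rewrite Nat.add_0_r, H0. lra.
    - rewrite Nat.add_succ_r. pose proof (Htri n (n + k)%nat).
      pose proof (Hstep (n + k)%nat). simpl.
      set (p := r ^ (n + k)) in *. nra. }
  destruct (pow_lt_eps r C (eps * (1 - r)) Hr HC) as [N HN]; [nra |].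
  assert (Hle : forall n m, (n >= N)%nat -> (n <= m)%nat -> D n m < eps).
  { intros n m Hn Hnm. replace m with (n + (m - n))%nat by lia.
    pose proof (Hsum n (m - n)%nat). pose proof (HN n Hn).
    assert (0 <= r ^ (n + (m - n))) by (apply pow_le; lra). nra. }
  exists N. intros n m Hn Hm. destruct (Nat.le_ge_cases n m) as [Hnm | Hnm].
  - now apply Hle.
  - rewrite Hsym. now apply Hle.
Qed.

(** * Neumann series and the norm bound on real spectral values *)

Section Spectrum.

Context {A : CStarAlgebra}.

Implicit Types a b c x y k : A.

Lemma eq_of_norm_sub_small a b :
  (forall eps, 0 < eps -> norm (a [-] b) <= eps) -> a = b.
Proof.
  intro H. assert (Hz : norm (a [-] b) = 0).
  { pose proof (norm_ge0 (a [-] b)).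
    destruct (Req_dec (norm (a [-] b)) 0) as [E | E]; [exact E |].
    pose proof (H (norm (a [-] b) / 2) ltac:(lra)). lra. }
  apply norm_eq0 in Hz. transitivity ((a [-] b) [+] b); [ncring |].
  rewrite Hz. ncring.
Qed.

Fixpoint geometric_sum x (n : nat) : A :=
  match n with O => zero | S m => geometric_sum x m [+] apow x m end.

(** The geometric series is Cauchy, and its limit is a two-sided inverse because its partial sums
    invert [one [-] x] up to [apow x n]. *)
Lemma neumann x : norm x < 1 -> invertible (one [-] x).
Proof.
  intro Hx. pose proof (norm_ge0 x) as Hx0.
  assert (Hl : forall n, (one [-] x) [*] geometric_sum x n = one [-] apow x n).
  { induction n as [| n IH]; simpl; [ncring |].
    rewrite mul_addr, IH. ncring. }
  assert (Hr : forall n, geometric_sum x n [*] (one [-] x) = one [-] apow x n).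
  { induction n as [| n IH]; simpl; [ncring |].
    rewrite mul_addl, IH, apow_comm. ncring. }
  destruct (complete A (geometric_sum x)) as [l Hlim].
  { apply (geometric_cauchy
      (fun n m => norm (geometric_sum x n [-] geometric_sum x m)) (norm x) 1).
    - lra.
    - lra.
    - intro n. replace (geometric_sum x n [-] geometric_sum x n) with (zero : A) by ncring.
      apply norm_zero.
    - intros n m. apply norm_sub_sym.
    - intros n m. apply norm_sub_triangle.
    - intro n. rewrite norm_sub_sym. simpl.
      replace (geometric_sum x n [+] apow x n [-] geometric_sum x n)
        with (apow x n) by ncring.
      rewrite Rmult_1_l. apply norm_apow. }
  set (K := norm (one [-] x)).
  assert (HK : 0 <= K) by apply norm_ge0.
  (* This quantity bounds the defect of [l] as an inverse on either side. *)
  assert (Hsmall : forall eps, 0 < eps -> exists n,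
    K * norm (geometric_sum x n [-] l) + norm (apow x n) <= eps).
  { intros eps Heps.
    destruct (Hlim (eps / (2 * (K + 1)))) as [N1 HN1];
      [apply Rdiv_lt_0_compat; lra |].
    destruct (pow_lt_eps (norm x) 1 (eps / 2)) as [N2 HN2]; [lra .. |].
    exists (N1 + N2)%nat.
    specialize (HN1 (N1 + N2)%nat ltac:(lia)). specialize (HN2 (N1 + N2)%nat ltac:(lia)).
    pose proof (norm_apow x (N1 + N2)).
    unfold Rdist in HN1. rewrite Rminus_0_r, Rabs_pos_eq in HN1 by apply norm_ge0.
    fold (sub (geometric_sum x (N1 + N2)) l) in HN1.
    apply (Rmult_lt_compat_r (2 * (K + 1))) in HN1; [| lra].
    replace (eps / (2 * (K + 1)) * (2 * (K + 1))) with eps in HN1 by (field; lra).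
    pose proof (norm_ge0 (geometric_sum x (N1 + N2) [-] l)). nra. }
  exists l. split; apply eq_of_norm_sub_small; intros eps Heps;
    destruct (Hsmall eps Heps) as [n Hn]; eapply Rle_trans; try exact Hn.
  - replace ((one [-] x) [*] l [-] one)
      with (opp ((one [-] x) [*] (geometric_sum x n [-] l)) [-] apow x n).
    + eapply Rle_trans; [apply norm_sub_le |]. rewrite norm_opp.
      apply Rplus_le_compat_r, norm_submult.
    + transitivity ((one [-] x) [*] l [-] (one [-] x) [*] geometric_sum x n [-] apow x n);
        [ncring |]. rewrite Hl. ncring.
  - replace (l [*] (one [-] x) [-] one)
      with (opp ((geometric_sum x n [-] l) [*] (one [-] x)) [-] apow x n).
    + eapply Rle_trans; [apply norm_sub_le |]. rewrite norm_opp.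
      apply Rplus_le_compat_r. rewrite Rmult_comm. apply norm_submult.
    + transitivity (l [*] (one [-] x) [-] geometric_sum x n [*] (one [-] x) [-] apow x n);
        [ncring |]. rewrite Hr. ncring.
Qed.

(** Factor out [t > 0] and apply the Neumann series to [x / t]. *)
Lemma invertible_real_sub (t : R) x : norm x < t -> invertible (scal (t, 0) one [-] x).
Proof.
  intro Ht. pose proof (norm_ge0 x).
  assert (Hinv : Cmul (t, 0) (/ t, 0) = C1).
  { unfold Cmul, C1; simpl. f_equal; field; lra. }
  replace (scal (t, 0) one [-] x)
    with (scal (t, 0) (one [-] scal (/ t, 0) x)).
  - apply (invertible_scal _ (/ t, 0)); [exact Hinv |]. apply neumann.
    rewrite norm_scal_real by (left; apply Rinv_0_lt_compat; lra).
    apply (Rmult_lt_reg_l t); [lra |]. field_simplify; lra.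
  - rewrite scal_sub, scal_assoc, Hinv, scal_one. reflexivity.
Qed.

Lemma spectrum_real_le (r : R) a : in_spectrum a (r, 0) -> r <= norm a.
Proof.
  intro H. apply Rnot_lt_le. intro Hr. apply H.
  replace (a [-] scal (r, 0) one) with (scal (-1, 0) (scal (r, 0) one [-] a))
    by (rewrite scal_m1; ncring).
  apply (invertible_scal _ (-1, 0)).
  - unfold Cmul, C1; simpl. f_equal; ring.
  - now apply invertible_real_sub.
Qed.

(** * The spectral radius of a self-adjoint element *)

(** By the resolvent identity an inverse at one point bounds all inverses at nearby points;
    compactness of a square containing the disc makes the bound uniform. *)
Lemma resolvent_bounded k :
  (forall z, Cmod z <= 1 -> invertible (one [-] scal z k)) ->
  exists M, 0 < M /\ forall z F, Cmod z <= 1 ->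
    inverse_of (one [-] scal z k) F -> norm F <= M.
Proof.
  intro Hinv.
  (* The same [e] is the radius of the neighbourhood and the reciprocal of the bound, so a uniform
     lower bound on the gauge is a uniform bound on the inverses. *)
  assert (Hloc : forall u v : R, exists e : posreal, forall (x y : R) F,
    Rabs (x - u) < e -> Rabs (y - v) < e -> Cmod (x, y) <= 1 ->
    inverse_of (one [-] scal (x, y) k) F -> norm F <= / e).
  { intros u v. destruct (Rle_or_lt (Cmod (u, v)) 1) as [Huv | Huv].
    - destruct (Hinv _ Huv) as [G HG].
      pose proof (norm_ge0 k) as Hk. pose proof (norm_ge0 G) as HG0.
      (* Large enough that a displacement of at most [2 / B] gives a factor at most [1 / 2] in the
         resolvent identity, and that [2 * norm G <= B]. *)
      set (B := 4 * (norm k + 1) * (norm G + 1)).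
      assert (HB : 0 < B) by (unfold B; nra).
      exists (mkposreal (/ B) (Rinv_0_lt_compat _ HB)). simpl.
      intros x y F Hx Hy _ HF. rewrite Rinv_inv.
      pose proof (norm_ge0 F) as HF0.
      assert (Hdist : Cmod (x - u, y - v) <= 2 * / B).
      { pose proof (Cmod_le_l1 (x - u) (y - v)). lra. }
      assert (Hsmall : Cmod (x - u, y - v) * norm k * norm G <= 1 / 2).
      { apply Rle_trans with (2 * / B * norm k * norm G).
        - apply Rmult_le_compat_r; [exact HG0 |]. now apply Rmult_le_compat_r.
        - apply (Rmult_le_reg_r B); [exact HB |].
          replace (2 * / B * norm k * norm G * B) with (2 * norm k * norm G)
            by (field; lra).
          unfold B. nra. }
      (* The term [norm F * (1 / 2)] is absorbed on the left, leaving [norm F <= 2 * norm G]. *)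
      assert (HFG : norm F <= norm G + norm F * (1 / 2)).
      { replace F with (G [+] (F [-] G)) at 1 by ncring.
        eapply Rle_trans; [apply norm_triangle |]. apply Rplus_le_compat_l.
        rewrite (inverse_of_sub _ _ _ _ HF HG).
        replace (one [-] scal (u, v) k [-] (one [-] scal (x, y) k))
          with (scal (x - u, y - v) k).
        + eapply Rle_trans; [apply norm_mul3 |]. rewrite norm_scal. nra.
        + transitivity (scal (x, y) k [-] scal (u, v) k); [| ncring].
          replace ((x, y) : Cx) with (Cadd (x - u, y - v) (u, v))
            by (unfold Cadd; simpl; f_equal; ring).
          rewrite scal_addl. ncring. }
      unfold B. nra.
    (* A centre outside the disc gets a neighbourhood that misses the disc, so the claim is vacuous
       there. *)
    - assert (He : 0 < (Cmod (u, v) - 1) / 2) by lra.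
      exists (mkposreal _ He). simpl. intros x y F Hx Hy Hxy _. exfalso.
      pose proof (Cmod_Cadd (u - x, v - y) (x, y)) as H.
      replace (Cadd (u - x, v - y) (x, y)) with ((u, v) : Cx) in H
        by (unfold Cadd; simpl; f_equal; ring).
      pose proof (Cmod_le_l1 (u - x) (v - y)).
      rewrite (Rabs_minus_sym x) in Hx. rewrite (Rabs_minus_sym y) in Hy. lra. }
  set (delta u v := proj1_sig (constructive_indefinite_description _ (Hloc u v))).
  destruct (Compactness.compactness_value_2d (-1) 1 (-1) 1 delta) as [e He].
  pose proof (cond_pos e) as He0.
  exists (/ e). split; [now apply Rinv_0_lt_compat |].
  intros [x y] F Hz HF. destruct (Cmod_coord_le _ _ Hz) as [Hx Hy].
  (* The compactness result provides the centre [(u, v)] only under a double negation. *)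
  apply NNPP. intro HN. apply (He x y Hx Hy). intros (u & v & _ & _ & Hu & Hv & Hle).
  apply HN. apply Rle_trans with (/ delta u v).
  - unfold delta in *.
    destruct (constructive_indefinite_description _ (Hloc u v)) as [e' He']. simpl in *.
    now apply (He' x y).
  - now apply Rinv_le_contravar.
Qed.

(** The invariant of repeated squaring: [F] and [G] invert [1 - z y] and [1 - rho z y]. [M] and
    [eps] stay fixed while [rho < 1] is squared towards 0, where the inverse is [one]. *)
Definition radially_close (M eps rho : R) y : Prop :=
  forall z, Cmod z <= 1 -> exists F G,
    inverse_of (one [-] scal z y) F /\
    inverse_of (one [-] scal (Cmul (rho, 0) z) y) G /\
    norm F <= M /\ norm G <= M /\ norm (F [-] G) <= eps.

(* The resolvent of [y^2] at [w^2] is the mean of the resolvents of [y] at [w] and [-w],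
   so the bounds pass from [y] to [y^2] unchanged. *)
Lemma radially_close_square (M eps rho : R) y :
  radially_close M eps rho y -> radially_close M eps (rho * rho) (y [*] y).
Proof.
  intros H z Hz. destruct (Csqrt_exists z) as [w Hw].
  assert (Hw1 : Cmod w <= 1).
  { rewrite <- Hw, Cmod_Cmul in Hz. pose proof (Cmod_ge0 w). nra. }
  (* The other square root of [z]. *)
  set (w' := Cmul (-1, 0) w).
  assert (Hw1' : Cmod w' <= 1).
  { unfold w'. rewrite Cmod_Cmul, Cmod_m1. lra. }
  destruct (H w Hw1) as (F1 & G1 & HF1 & HG1 & NF1 & NG1 & N1).
  destruct (H w' Hw1') as (F2 & G2 & HF2 & HG2 & NF2 & NG2 & N2).
  assert (Hsq : forall (v : Cx) P Q, inverse_of (one [-] scal v y) P ->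
    inverse_of (one [-] scal (Cmul (-1, 0) v) y) Q ->
    inverse_of (one [-] scal (Cmul v v) (y [*] y)) (scal (1 / 2, 0) (P [+] Q))).
  { intros v P Q HP HQ. rewrite <- scal_assoc, scal_mull, scal_mulr.
    rewrite <- scal_assoc, scal_m1 in HQ.
    apply inverse_of_one_sub_square; [exact HP |].
    replace (one [+] scal v y) with (one [-] opp (scal v y)) by ncring. exact HQ. }
  assert (Hmean : forall (P Q : A) (c : R), norm P <= c -> norm Q <= c ->
    norm (scal (1 / 2, 0) (P [+] Q)) <= c).
  { intros P Q c HP HQ. rewrite norm_scal_real by lra.
    pose proof (norm_triangle _ P Q). lra. }
  exists (scal (1 / 2, 0) (F1 [+] F2)), (scal (1 / 2, 0) (G1 [+] G2)).
  split; [| split; [| split; [| split]]].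
  - rewrite <- Hw. now apply Hsq.
  - replace (Cmul (rho * rho, 0) z) with (Cmul (Cmul (rho, 0) w) (Cmul (rho, 0) w))
      by (rewrite <- Hw; unfold Cmul; simpl; f_equal; ring).
    apply Hsq; [exact HG1 |].
    replace (Cmul (-1, 0) (Cmul (rho, 0) w)) with (Cmul (rho, 0) w')
      by (unfold w', Cmul; simpl; f_equal; ring).
    exact HG2.
  - now apply Hmean.
  - now apply Hmean.
  - rewrite <- scal_sub.
    replace (F1 [+] F2 [-] (G1 [+] G2)) with ((F1 [-] G1) [+] (F2 [-] G2)) by ncring.
    now apply Hmean.
Qed.

Fixpoint iterated_square x (m : nat) : A :=
  match m with O => x | S n => iterated_square x n [*] iterated_square x n end.

Lemma iterated_square_selfadjoint x (m : nat) :
  star x = x -> star (iterated_square x m) = iterated_square x m.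
Proof. intro Hx. induction m as [| m IH]; simpl; [exact Hx |]. now rewrite star_mul, IH. Qed.

(** For self-adjoint [y] the C*-identity says that the norm of [y [*] y] is the square of that of
    [y]. *)
Lemma norm_iterated_square x (m : nat) :
  star x = x -> norm x = 1 -> norm (iterated_square x m) = 1.
Proof.
  intros Hx H1. induction m as [| m IH]; simpl; [exact H1 |].
  pose proof (norm_cstar A (iterated_square x m)) as H.
  rewrite iterated_square_selfadjoint in H by exact Hx. rewrite H, IH. ring.
Qed.

Lemma selfadjoint_resolvent_not_total k :
  star k = k -> norm k = 1 ->
  ~ (forall z, Cmod z <= 1 -> invertible (one [-] scal z k)).
Proof.
  intros Hk Hk1 Hinv. destruct (resolvent_bounded k Hinv) as (M & HM & HMb).
  (* Chosen so that the resolvent identity between [z] and [(1 - t) z] gives a difference of at most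
     [M * t * M <= 1 / 4]. *)
  set (t := 1 / (4 * (M * M + 1))).
  assert (Hteq : t * (4 * (M * M + 1)) = 1) by (unfold t; field; nra).
  assert (Ht0 : 0 < t) by (apply Rdiv_lt_0_compat; nra).
  clearbody t.
  assert (HMt : 0 < M * M * t) by (apply Rmult_lt_0_compat; nra).
  assert (Ht : 0 < t < 1) by lra.
  assert (HtM : M * t * M <= 1 / 4) by lra.
  assert (Hclose : radially_close M (1 / 4) (1 - t) k).
  { intros z Hz.
    assert (Hz' : Cmod (Cmul (1 - t, 0) z) <= 1).
    { rewrite Cmod_Cmul, Cmod_real_ge0 by lra. pose proof (Cmod_ge0 z). nra. }
    destruct (Hinv z Hz) as [F HF]. destruct (Hinv _ Hz') as [G HG].
    pose proof (HMb _ _ Hz HF) as NF. pose proof (HMb _ _ Hz' HG) as NG.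
    exists F, G. do 4 (split; [assumption |]).
    rewrite (inverse_of_sub _ _ _ _ HF HG).
    replace (one [-] scal (Cmul (1 - t, 0) z) k [-] (one [-] scal z k))
      with (scal (Cmul (t, 0) z) k).
    - eapply Rle_trans; [apply norm_mul3 |]. eapply Rle_trans; [| exact HtM].
      rewrite norm_scal, Hk1, Cmod_Cmul, Cmod_real_ge0 by lra.
      pose proof (norm_ge0 F). pose proof (norm_ge0 G). pose proof (Cmod_ge0 z).
      apply Rmult_le_compat; [| assumption | | assumption].
      + repeat apply Rmult_le_pos; lra.
      + apply Rmult_le_compat; [assumption | | assumption |].
        * repeat apply Rmult_le_pos; lra.
        * nra.
    - transitivity (scal z k [-] scal (Cmul (1 - t, 0) z) k); [| ncring].
      replace (scal z k) with (scal (Cadd (Cmul (t, 0) z) (Cmul (1 - t, 0) z)) k).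
      + rewrite scal_addl. ncring.
      + f_equal. destruct z. unfold Cadd, Cmul; simpl. f_equal; ring. }
  (* The exponent doubles with each squaring; [m < n] records enough growth to make [(1 - t) ^ n]
     small. *)
  assert (Hpow : forall m, exists n, (m < n)%nat /\
    radially_close M (1 / 4) ((1 - t) ^ n) (iterated_square k m)).
  { induction m as [| m (n & Hn & IH)].
    - exists 1%nat. split; [lia |]. simpl. now rewrite Rmult_1_r.
    - exists (n + n)%nat. split; [lia |]. rewrite pow_add.
      now apply radially_close_square. }
  destruct (pow_lt_eps (1 - t) M (1 / 8)) as [N HN]; [lra .. |].
  destruct (Hpow N) as (n & Hn & Hy). specialize (HN n ltac:(lia)).
  pose proof (norm_iterated_square k N Hk Hk1) as Hy1.
  set (y := iterated_square k N) in *. set (s := (1 - t) ^ n) in *.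
  assert (Hs : 0 <= s) by (apply pow_le; lra).
  destruct (Hy C1) as (F & G & [HF _] & [_ HG] & NF & NG & NFG).
  { unfold C1. rewrite Cmod_real_ge0; lra. }
  rewrite scal_one in HF.
  replace (Cmul (s, 0) C1) with ((s, 0) : Cx) in HG
    by (unfold Cmul, C1; simpl; f_equal; ring).
  (* Since [G] inverts [1 - s y], the difference [G - 1] equals [G] times [s y], of norm at most
     [M * s]. *)
  assert (HG1 : norm (G [-] one) <= 1 / 8).
  { replace (G [-] one) with (G [*] scal (s, 0) y).
    - eapply Rle_trans; [apply norm_submult |].
      rewrite norm_scal_real, Hy1 by exact Hs. nra.
    - rewrite <- HG. ncring. }
  assert (Hy_eq : y = (one [-] y) [*] (F [-] one)).
  { transitivity ((one [-] y) [*] F [-] (one [-] y)); [rewrite HF |]; ncring. }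
  (* The factor 2 bounds [1 - y], and [3 / 8 = 1 / 4 + 1 / 8] bounds [F - 1] by way of [G]. The
     result contradicts [norm y = 1]. *)
  assert (Hlt : norm y <= 2 * (3 / 8)).
  { rewrite Hy_eq at 1. eapply Rle_trans; [apply norm_submult |].
    apply Rmult_le_compat; try apply norm_ge0.
    - pose proof (norm_sub_le one y). pose proof (@norm_one_le A). lra.
    - pose proof (norm_sub_triangle F G one). lra. }
  lra.
Qed.

(** Otherwise every [l] with [norm a <= Cmod l] is outside the spectrum, and then [1 - z k] is
    invertible on the whole closed disc for [k = a / norm a]. *)
Lemma selfadjoint_spectral_radius a :
  star a = a -> a <> zero -> exists l, in_spectrum a l /\ norm a <= Cmod l.
Proof.
  intros Ha Hnz. pose proof (norm_gt0 a Hnz) as Hn. set (r := norm a) in *.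
  apply NNPP. intro Hno.
  apply (selfadjoint_resolvent_not_total (scal (/ r, 0) a)).
  - now rewrite star_scal_real, Ha.
  - rewrite norm_scal_real by (left; now apply Rinv_0_lt_compat).
    apply Rinv_l, Rgt_not_eq, Hn.
  - intros z Hz.
    set (q := fst z * fst z + snd z * snd z).
    destruct (Req_dec q 0) as [Hq | Hq].
    + replace z with ((0, 0) : Cx)
        by (destruct z; unfold q in Hq; simpl in Hq; f_equal; nra).
      rewrite scal_0. exists one. split; ncring.
    (* The inverse of [z]. With [l = r / z], of modulus at least [r], one has
       [1 - z a / r = -(z / r) (a - l)]. *)
    + set (zi := (fst z / q, - snd z / q) : Cx).
      assert (Hzi : Cmul z zi = C1).
      { unfold Cmul, zi, C1; simpl. f_equal; unfold q in *; field; exact Hq. }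
      set (l := Cmul (r, 0) zi).
      assert (Hl : r <= Cmod l).
      { assert (Hm : Cmod z * Cmod zi = 1).
        { rewrite <- Cmod_Cmul, Hzi. unfold C1. apply Cmod_real_ge0. lra. }
        unfold l. rewrite Cmod_Cmul, Cmod_real_ge0 by lra.
        pose proof (Cmod_ge0 z). pose proof (Cmod_ge0 zi). assert (1 <= Cmod zi) by nra. nra. }
      assert (Hinv : invertible (a [-] scal l one)).
      { apply NNPP. intro HN. apply Hno. now exists l. }
      replace (one [-] scal z (scal (/ r, 0) a))
        with (scal (Cmul (- / r, 0) z) (a [-] scal l one)).
      * apply (invertible_scal _ (Cmul (- r, 0) zi)); [| exact Hinv].
        transitivity (Cmul (Cmul (- / r, 0) (- r, 0)) (Cmul z zi)).
        -- unfold Cmul; simpl; f_equal; ring.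
        -- rewrite Hzi. unfold Cmul, C1; simpl. f_equal; field; lra.
      * rewrite scal_sub, !scal_assoc.
        replace (Cmul (Cmul (- / r, 0) z) l) with (Cmul (-1, 0) C1).
        -- replace (Cmul (- / r, 0) z) with (Cmul (-1, 0) (Cmul z (/ r, 0)))
             by (unfold Cmul; simpl; f_equal; ring).
           rewrite <- !(scal_assoc _ (-1, 0)), !scal_m1, scal_one. ncring.
        -- rewrite <- Hzi. unfold l, Cmul; simpl. f_equal; field; lra.
Qed.

(** * Monotonicity of the norm on positive elements *)

(** Positivity makes the spectral value of largest modulus real and nonnegative, and
    [spectrum_real_le] caps it at [norm a]. *)
Lemma positive_norm_in_spectrum a :
  apositive a -> a <> zero -> in_spectrum a (norm a, 0).
Proof.
  intros [Ha Hs] Hnz.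
  destruct (selfadjoint_spectral_radius a Ha Hnz) as ([r i] & Hl & Hr).
  destruct (Hs _ Hl) as [Hi Hr0]. simpl in Hi, Hr0. subst i.
  pose proof (spectrum_real_le _ _ Hl). rewrite Cmod_real_ge0 in Hr by lra.
  now replace (norm a) with r by lra.
Qed.

(** A spectral value [r] of [t - a] that dominates its norm corresponds to [t - r] in the spectrum
    of [a]; the latter lies between 0 and [norm a <= t], so [0 <= r <= t]. *)
Lemma positive_norm_real_sub (t : R) a :
  apositive a -> norm a <= t -> norm (scal (t, 0) one [-] a) <= t.
Proof.
  intros [Ha Hs] Ht. pose proof (norm_ge0 a).
  destruct (classic (scal (t, 0) one [-] a = zero)) as [E | E].
  { rewrite E, norm_zero. lra. }
  destruct (selfadjoint_spectral_radius (scal (t, 0) one [-] a)) as ([r i] & Hl & Hr);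
    [| exact E |].
  { now rewrite star_sub, star_scal_real, star_one, Ha. }
  assert (Hl' : in_spectrum a (t - r, - i)).
  { intro Hinv. apply Hl.
    replace (scal (t, 0) one [-] a [-] scal (r, i) one)
      with (scal (-1, 0) (a [-] scal (t - r, - i) one)).
    - apply (invertible_scal _ (-1, 0)); [| exact Hinv].
      unfold Cmul, C1; simpl. f_equal; ring.
    - rewrite scal_m1.
      replace ((t, 0) : Cx) with (Cadd (t - r, - i) (r, i))
        by (unfold Cadd; simpl; f_equal; ring).
      rewrite scal_addl. ncring. }
  destruct (Hs _ Hl') as [Hi Hr0]. simpl in Hi, Hr0.
  rewrite Hi in Hl'. pose proof (spectrum_real_le _ _ Hl').
  replace i with 0 in Hr by lra. rewrite Cmod_real_ge0 in Hr by lra. lra.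
Qed.

(* With [c = b - a] and [|b| < |a|], the element [|a| - a = (|a| - b) + c] would be
   invertible, being at distance at most [|b| + |c|] from the scalar [|a| + |c|]. *)
Lemma norm_monotone a b : apositive a -> ale a b -> norm a <= norm b.
Proof.
  intros Ha Hc. unfold ale in Hc.
  destruct (classic (a = zero)) as [E | E].
  { rewrite E, norm_zero. apply norm_ge0. }
  apply Rnot_lt_le. intro Hlt. apply (positive_norm_in_spectrum a Ha E).
  set (c := b [-] a) in *. set (s := norm a) in *. set (t := norm c).
  pose proof (positive_norm_real_sub t c Hc (Rle_refl _)) as Hct.
  replace (a [-] scal (s, 0) one)
    with (scal (-1, 0) (scal (s + t, 0) one [-] (b [+] (scal (t, 0) one [-] c)))).
  - apply (invertible_scal _ (-1, 0)).
    + unfold Cmul, C1; simpl. f_equal; ring.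
    + apply invertible_real_sub.
      pose proof (norm_triangle _ b (scal (t, 0) one [-] c)). lra.
  - rewrite scal_m1.
    replace ((s + t, 0) : Cx) with (Cadd (s, 0) (t, 0))
      by (unfold Cadd; simpl; f_equal; ring).
    rewrite scal_addl. unfold c. ncring.
Qed.

End Spectrum.

(** * The fixed point theorem *)

Section Metric.

Context {A : CStarAlgebra} {X : Type} (d : X -> X -> A) (Hd : is_cstar_metric d).

Lemma norm_dist_sym (x y : X) : norm (d x y) = norm (d y x).
Proof. destruct Hd as (_ & _ & Hsym & _). now rewrite Hsym. Qed.

Lemma norm_dist_triangle (x y z : X) :
  norm (d x y) <= norm (d x z) + norm (d z y).
Proof.
  destruct Hd as (Hpos & _ & _ & Htri).
  eapply Rle_trans; [| apply norm_triangle]. apply norm_monotone; auto.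
Qed.

Lemma norm_dist_refl (x : X) : norm (d x x) = 0.
Proof. destruct Hd as (_ & H0 & _). now apply norm_eq0, H0. Qed.

Lemma convergesE (u : nat -> X) (x : X) :
  converges d u x <->
  forall eps, 0 < eps -> exists N, forall n, (n >= N)%nat -> norm (d (u n) x) < eps.
Proof.
  unfold converges, Un_cv, Rdist.
  split; intros H eps Heps; destruct (H eps Heps) as [N HN]; exists N; intros n Hn;
    specialize (HN n Hn); rewrite Rminus_0_r, Rabs_pos_eq in * by apply norm_ge0;
    exact HN.
Qed.

Lemma dist_small_eq (x y : X) :
  (forall eps, 0 < eps -> norm (d x y) < eps) -> x = y.
Proof.
  intro H. destruct Hd as (_ & H0 & _). apply H0, norm_eq0.
  pose proof (norm_ge0 (d x y)) as Hn.
  destruct (Req_dec (norm (d x y)) 0) as [E | E]; [exact E |].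
  pose proof (H (norm (d x y)) ltac:(lra)). lra.
Qed.

Lemma converges_unique (u : nat -> X) (x y : X) :
  converges d u x -> converges d u y -> x = y.
Proof.
  rewrite !convergesE. intros Hx Hy. apply dist_small_eq. intros eps Heps.
  destruct (Hx (eps / 2)) as [N1 H1]; [lra |].
  destruct (Hy (eps / 2)) as [N2 H2]; [lra |].
  specialize (H1 (N1 + N2)%nat ltac:(lia)). specialize (H2 (N1 + N2)%nat ltac:(lia)).
  pose proof (norm_dist_triangle x y (u (N1 + N2)%nat)) as H.
  rewrite (norm_dist_sym x (u _)) in H. lra.
Qed.

Lemma converges_subseq (u : nat -> X) (x : X) (f : nat -> nat) :
  (forall i, (i <= f i)%nat) -> converges d u x -> converges d (fun i => u (f i)) x.
Proof.
  rewrite !convergesE. intros Hf H eps Heps. destruct (H eps Heps) as [N HN].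
  exists N. intros n Hn. apply HN. specialize (Hf n). lia.
Qed.

Lemma strictly_increasing_ge (f : nat -> nat) :
  (forall i, (f i < f (S i))%nat) -> forall i, (i <= f i)%nat.
Proof.
  intros Hf i. induction i as [| i IH]; [lia |]. specialize (Hf i). lia.
Qed.

(** Every subsequence of every orbit tends to [u], so continuity has content only at [u], where the
    shifted subsequence tends to [u = T u]. *)
Lemma orbitally_continuous_of_global_limit (T : X -> X) (u : X) :
  T u = u -> (forall x, converges d (fun n => Nat.iter n T x) u) ->
  orbitally_continuous d T.
Proof.
  intros Hu Hlim w x ni _ Hinc Hw.
  pose proof (strictly_increasing_ge ni Hinc) as Hge.
  assert (w = u) as ->.
  { apply (converges_unique _ _ _ Hw).
    apply (converges_subseq (fun n => Nat.iter n T x) u ni); auto. }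
  rewrite Hu.
  apply (converges_subseq (fun n => Nat.iter n T x) u (fun i => S (ni i))); [| apply Hlim].
  intro i. specialize (Hge i). lia.
Qed.

Lemma orbit_limit_fixed (T : X -> X) (x u : X) :
  orbitally_continuous d T -> converges d (fun n => Nat.iter n T x) u -> T u = u.
Proof.
  intros Hoc Hu.
  apply (converges_unique (fun i => Nat.iter (S (S i)) T x)).
  (* Indices must be positive, so the full orbit is entered as [i + 1]. *)
  - apply (Hoc u x S); [intro; lia | intro; lia |].
    apply (converges_subseq (fun n => Nat.iter n T x) u S); [intro; lia | exact Hu].
  - apply (converges_subseq (fun n => Nat.iter n T x) u (fun i => S (S i)));
      [intro; lia | exact Hu].
Qed.

Lemma norm_contraction (T S : X -> X) (q delta : X -> X -> A) :
  (forall x y (n : nat), (1 <= n)%nat ->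
     ale (d (Nat.iter n T x) (Nat.iter n S y)) (mul (apow (q x y) n) (delta x y))) ->
  forall x y, exists C, 0 <= C /\
    forall n, norm (d (Nat.iter n T x) (Nat.iter n S y)) <= C * norm (q x y) ^ n.
Proof.
  intros Hcontr x y. pose proof (norm_ge0 (d x y)). pose proof (norm_ge0 (delta x y)).
  (* The first summand covers [n = 0], on which the contraction hypothesis is silent. *)
  exists (norm (d x y) + norm (delta x y)). split; [lra |].
  intros [| n].
  - simpl. lra.
  - apply Rle_trans with (norm (apow (q x y) (Datatypes.S n) [*] delta x y)).
    + apply norm_monotone; [apply Hd |]. apply Hcontr. lia.
    + eapply Rle_trans; [apply norm_submult |].
      pose proof (norm_apow (q x y) (Datatypes.S n)). pose proof (norm_ge0 (q x y)) as Hq.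
      pose proof (pow_le _ (Datatypes.S n) Hq). nra.
Qed.

End Metric.

Theorem theorem3p16 (A : CStarAlgebra) (X : Type) (HX : inhabited X)
  (d : X -> X -> A) (Hd : is_cstar_metric d) (Hcomp : complete_metric d)
  (T S : X -> X) (q delta : X -> X -> A)
  (Hq : forall x y, central_positive (q x y) /\ 0 <= norm (q x y) < 1)
  (Hdelta : forall x y, apositive (delta x y))
  (Hcontr : forall x y (n : nat), (1 <= n)%nat ->
     ale (d (Nat.iter n T x) (Nat.iter n S y)) (mul (apow (q x y) n) (delta x y))) :
  (orbitally_continuous d T /\ orbitally_continuous d S) <->
  (exists u, (T u = u /\ S u = u) /\ forall v, T v = v /\ S v = v -> v = u).
Proof.
  pose proof (norm_contraction d Hd T S q delta Hcontr) as Hgeo.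
  assert (Hsmall : forall x y eps, 0 < eps -> exists N, forall n, (n >= N)%nat ->
    norm (d (Nat.iter n T x) (Nat.iter n S y)) < eps).
  { intros x y eps Heps. destruct (Hgeo x y) as (C & HC & Hb).
    destruct (pow_lt_eps (norm (q x y)) C eps) as [N HN]; [apply Hq | exact HC | exact Heps |].
    exists N. intros n Hn. eapply Rle_lt_trans; [apply Hb | now apply HN]. }
  assert (Hfix : forall (f : X -> X) u n, f u = u -> Nat.iter n f u = u).
  { intros f u n Hu. induction n as [| n IH]; simpl; [reflexivity |]. now rewrite IH. }
  split.
  - intros [HT HS]. destruct HX as [x].
    (* Both [T^n x] and [T^n (T x)] are compared with [S^n x]; the maximum [r] of the two rates is a
       common one for consecutive terms of the [T]-orbit. *)
    destruct (Hgeo x x) as (K1 & HK1 & Hb1). destruct (Hgeo (T x) x) as (K2 & HK2 & Hb2).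
    pose proof (proj2 (Hq x x)) as Hr1. pose proof (proj2 (Hq (T x) x)) as Hr2.
    set (r := Rmax (norm (q x x)) (norm (q (T x) x))).
    assert (Hr : 0 <= r < 1) by (unfold r, Rmax; destruct Rle_dec; lra).
    destruct (Hcomp (fun n => Nat.iter n T x)) as [u Hu].
    { unfold cauchy. apply (geometric_cauchy
        (fun n m => norm (d (Nat.iter n T x) (Nat.iter m T x))) r (K1 + K2)).
      - exact Hr.
      - lra.
      - intro n. now apply norm_dist_refl.
      - intros n m. now apply norm_dist_sym.
      - intros n m. now apply norm_dist_triangle.
      - intro n. eapply Rle_trans;
          [apply (norm_dist_triangle d Hd _ _ (Nat.iter n S x)) |].
        rewrite (norm_dist_sym d Hd (Nat.iter n S x)), Nat.iter_succ_r.
        assert (norm (q x x) ^ n <= r ^ n)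
          by (apply pow_incr; split; [lra | apply Rmax_l]).
        assert (norm (q (T x) x) ^ n <= r ^ n)
          by (apply pow_incr; split; [lra | apply Rmax_r]).
        specialize (Hb1 n). specialize (Hb2 n). nra. }
    assert (HuS : converges d (fun n => Nat.iter n S x) u).
    { apply convergesE. intros eps Heps.
      destruct (proj1 (convergesE d _ _) Hu (eps / 2)) as [N1 H1]; [lra |].
      destruct (Hsmall x x (eps / 2)) as [N2 H2]; [lra |].
      exists (N1 + N2)%nat. intros n Hn.
      specialize (H1 n ltac:(lia)). specialize (H2 n ltac:(lia)).
      pose proof (norm_dist_triangle d Hd (Nat.iter n S x) u (Nat.iter n T x)) as H.
      rewrite (norm_dist_sym d Hd (Nat.iter n S x) (Nat.iter n T x)) in H. lra. }
    exists u. split.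
    + split; eapply orbit_limit_fixed; eauto.
    (* Here [v = T^N v] and [u = S^N u], so [Hsmall] makes their distance arbitrarily small. *)
    + intros v [HTv _]. apply (dist_small_eq d Hd). intros eps Heps.
      destruct (Hsmall v u eps Heps) as [N HN]. specialize (HN N (le_n N)).
      rewrite (Hfix T v N HTv), (Hfix S u N) in HN; [exact HN |].
      now apply (orbit_limit_fixed d Hd S x).
  - intros (u & [HTu HSu] & _).
    split; apply (orbitally_continuous_of_global_limit d Hd _ u); try assumption;
      intro x; apply convergesE; intros eps Heps.
    (* The constant orbit of [u] under one map attracts every orbit of the other. *)
    + destruct (Hsmall x u eps Heps) as [N HN]. exists N. intros n Hn.
      specialize (HN n Hn). now rewrite (Hfix S u n HSu) in HN.
    + destruct (Hsmall u x eps Heps) as [N HN]. exists N. intros n Hn.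
      specialize (HN n Hn). now rewrite (Hfix T u n HTu), norm_dist_sym in HN.
Qed.
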